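(* Let $\delta\ge3$ be finite, let $C_0>2\delta+3$ be even with $C_0\le 3\delta+2$, and let $\mathcal S$ be an admissible set of Henson constraints for $\mathcal A^\delta_{\infty,0,C_0,2\delta+1}$. Then the class $\mathcal A^\delta_{\infty,0,C_0,2\delta+1}\cap\mathcal A_{\mathcal S}$ has coherent EPPA.
   Context: $\mathcal A^\delta_{\infty,0,C_0,2\delta+1}$ is the class of finite metric spaces with integer distances in $\{1,\dots,\delta\}$ containing no triangle of odd perimeter and no triangle of even perimeter $\ge C_0$. A Henson constraint is a metric space all of whose distances are $1$ or $\delta$; $\mathcal A_{\mathcal S}$ is the class of finite metric spaces into which no member of $\mathcal S$ embeds; $\mathcal S$ is admissible here if it is a set of Henson constraints each with at least 4 points and containing no triangle forbidden in $\mathcal A^\delta_{\infty,0,C_0,2\delta+1}$. A class $\mathcal K$ has coherent EPPA if for every $\mathbf A\in\mathcal K$ there is $\mathbf B\in\mathcal K$ containing $\mathbf A$ as a substructure such that every partial automorphism $f$ (isomorphism between substructures) of $\mathbf A$ extends to an automorphism $\hat f$ of $\mathbf B$, and the map $f\mapsto\hat f$ is coherent: whenever $\mathrm{Dom}(f)=\mathrm{Dom}(h)$, $\mathrm{Range}(f)=\mathrm{Dom}(g)$, $\mathrm{Range}(g)=\mathrm{Range}(h)$ and $h=g\circ f$, also $\hat h=\hat g\circ\hat f$. *)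

(* Defs.v *)
From mathcomp Require Import all_boot.

Set Implicit Arguments.
Unset Strict Implicit.
Unset Printing Implicit Defensive.

Record is_metric (T : Type) (d : T -> T -> nat) : Prop := IsMetric {
  metric_eq0 : forall x y, d x y = 0 <-> x = y;
  metric_sym : forall x y, d x y = d y x;
  metric_triangle : forall x y z, d x z <= d x y + d y z
}.

(* Every space in play has distances in {1, ..., delta}, so metrics take
   natural number values. *)
Record metricSpace := MetricSpace {
  point :> Type;
  dist : point -> point -> nat;
  dist_metric : is_metric dist
}.

Record finMetricSpace := FinMetricSpace {
  fpoint :> finType;
  fdist : fpoint -> fpoint -> nat;
  fdist_metric : is_metric fdist
}.

Coercion metricSpace_of_fin (X : finMetricSpace) : metricSpace :=
  MetricSpace (@fdist_metric X).

(* Distance preservation implies injectivity, by metric_eq0. *)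
Definition isometric (X Y : metricSpace) (f : X -> Y) : Prop :=
  forall x y, dist (f x) (f y) = dist x y.

Definition embeds (X Y : metricSpace) : Prop :=
  exists f : X -> Y, isometric f.

Definition triangle (X : metricSpace) (x y z : X) : Prop :=
  [/\ x <> y, y <> z & x <> z].

Definition perimeter (X : metricSpace) (x y z : X) : nat :=
  dist x y + dist y z + dist x z.

Definition forbidden_perimeter (C0 p : nat) : Prop :=
  odd p \/ (~~ odd p /\ C0 <= p).

Definition no_forbidden_triangle (C0 : nat) (X : metricSpace) : Prop :=
  forall x y z : X, triangle x y z -> ~ forbidden_perimeter C0 (perimeter x y z).

(* The class A^delta_{oo, 0, C0, 2 delta + 1}. *)
Definition bipartite_class (delta C0 : nat) (X : finMetricSpace) : Prop :=
  (forall x y : X, x <> y -> 1 <= fdist x y <= delta) /\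
  no_forbidden_triangle C0 X.

Definition henson_constraint (delta : nat) (X : metricSpace) : Prop :=
  forall x y : X, x <> y -> dist x y = 1 \/ dist x y = delta.

Definition omitting_class (S : metricSpace -> Prop) (X : finMetricSpace) : Prop :=
  forall H : metricSpace, S H -> ~ embeds H X.

Definition admissible (delta C0 : nat) (S : metricSpace -> Prop) : Prop :=
  forall H : metricSpace, S H ->
    [/\ henson_constraint delta H,
        (exists p : 'I_4 -> H, injective p) &
        no_forbidden_triangle C0 H].

Definition pfun (A : finType) := {ffun A -> option A}.

Definition pdom (A : finType) (f : pfun A) : {set A} := [set x | isSome (f x)].

Definition prange (A : finType) (f : pfun A) : {set A} :=
  [set y | [exists x, f x == Some y]].

Definition pcomp (A : finType) (g f : pfun A) : pfun A :=
  [ffun x => obind g (f x)].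

(* An isomorphism from the subspace on pdom f onto the one on prange f;
   injectivity follows from metric_eq0. *)
Definition partial_automorphism (A : finMetricSpace) (f : pfun A) : Prop :=
  forall x y x' y' : A,
    f x = Some x' -> f y = Some y' -> fdist x' y' = fdist x y.

Definition automorphism (B : finMetricSpace) (s : B -> B) : Prop :=
  bijective s /\ forall x y, fdist (s x) (s y) = fdist x y.

(* i is the inclusion of A in B, and the values of ext outside the partial
   automorphisms of A are irrelevant. *)
Definition coherent_EPPA (K : finMetricSpace -> Prop) : Prop :=
  forall A : finMetricSpace, K A ->
  exists (B : finMetricSpace) (i : A -> B) (ext : pfun A -> B -> B),
    [/\ K B,
        @isometric A B i,
        (forall f : pfun A, partial_automorphism f ->
           automorphism (ext f) /\
           forall x y, f x = Some y -> ext f (i x) = i y) &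
        (forall f g h : pfun A,
           partial_automorphism f -> partial_automorphism g ->
           partial_automorphism h ->
           pdom f = pdom h -> prange f = pdom g -> prange g = prange h ->
           h = pcomp g f -> ext h =1 ext g \o ext f)].

(* Main.v *)
Require Import Defs.
From mathcomp Require Import all_boot.
From mathcomp Require Import ssralg zmodp zify boolp.

Set Implicit Arguments.
Unset Strict Implicit.
Unset Printing Implicit Defensive.

(** Put [u := C0 / 2 - 1].  Doubling every vertex [x] into [x+], [x-], with
    weight [d x y] between equal signs and [u - d x y] between opposite signs,
    turns the allowed triangles into the ordinary triangle inequality together
    with [d x+ x- = u].  Hence a graph with labels in [1..delta] completes to a
    space of the class as soon as it is bipartite and has no walk from [x+] to
    [x-] of weight less than [u]: the distance of [x], [y] is obtained by
    clamping the element of [{delta/2, delta/2 + 1}] of the right parity between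
    the bounds [u - D x+ y-] and [D x+ y+], where [D] is the path distance.

    A bipartite labelled graph in which the partial automorphisms of [A] extend
    coherently is built from valuations of pairs.  Short walks from [x+] to [x-]
    and large [delta]-cliques are then destroyed by further covers, whose
    vertices carry a valuation of every bad configuration: a value in a set too
    small for a large clique, or a bit that must change exactly once around a
    bad walk.  A minimal bad walk whose closing edge lies in [A] has no further
    vertex in [A], so [A] lifts, and the valuations can be permuted or translated
    to extend partial automorphisms.  Finally, parity forces Henson constraints
    to be [delta]-cliques, and the completion creates no new distance [delta]. *)

(** * Coherent extension of partial injections *)

Section PartialInjections.

Variable T : finType.
Implicit Types q r : pfun T.

Definition pinjective q := forall x y z, q x = Some z -> q y = Some z -> x = y.

(** Points outside the domain are matched with points outside the range by their position in the
    fixed enumeration of [T]. This canonical choice is what makes the extension coherent. The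
    default of [nth] is never reached for injective [q], since both complements have the same
    size. *)
Definition perm_extension q (x : T) : T :=
  if q x is Some y then y
  else nth x (enum (~: prange q)) (index x (enum (~: pdom q))).

Lemma in_pdom q x y : q x = Some y -> x \in pdom q.
Proof. by move=> e; rewrite inE e. Qed.

Lemma in_prange q x y : q x = Some y -> y \in prange q.
Proof. by move=> e; rewrite inE; apply/existsP; exists x; rewrite e. Qed.

Lemma prangeP q y : reflect (exists x, q x = Some y) (y \in prange q).
Proof.
rewrite inE; apply: (iffP existsP) => -[x /eqP e]; first by exists x.
by exists x; rewrite e.
Qed.

Lemma pdomPn q x : x \notin pdom q -> q x = None.
Proof. by rewrite inE; case: (q x). Qed.

Lemma perm_extensionE q x y : q x = Some y -> perm_extension q x = y.
Proof. by rewrite /perm_extension => ->. Qed.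

Lemma card_prange q : pinjective q -> #|prange q| = #|pdom q|.
Proof.
move=> qI.
pose g x := odflt x (q x).
have -> : prange q = g @: pdom q.
  apply/setP=> y; apply/prangeP/imsetP => [[x e]|[x]].
    by exists x; [apply: in_pdom e | rewrite /g e].
  by rewrite inE /g; case e: (q x) => [z|] // _ ->; exists x.
apply: card_in_imset => x y; rewrite !inE /g.
case ex: (q x) => [a|] //; case ey: (q y) => [b|] //= _ _ eab.
by apply: qI ex _; rewrite ey eab.
Qed.

Section Out.

Variables (q : pfun T) (qI : pinjective q).

Lemma size_enum_out : size (enum (~: prange q)) = size (enum (~: pdom q)).
Proof.
rewrite -!cardE; have := card_prange qI.
by have := cardsC (pdom q); have := cardsC (prange q); lia.
Qed.

Lemma perm_extension_index x : x \notin pdom q ->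
  index (perm_extension q x) (enum (~: prange q)) =
  index x (enum (~: pdom q)).
Proof.
move=> xq; rewrite /perm_extension pdomPn // index_uniq ?enum_uniq //.
by rewrite size_enum_out index_mem mem_enum inE.
Qed.

Lemma perm_extension_out x :
  x \notin pdom q -> perm_extension q x \notin prange q.
Proof.
move=> xq; rewrite -in_setC -mem_enum -index_mem perm_extension_index //.
by rewrite size_enum_out index_mem mem_enum inE.
Qed.

Lemma perm_extension_prange x :
  (perm_extension q x \in prange q) = (x \in pdom q).
Proof.
have [xq|/perm_extension_out/negbTE //] := boolP (x \in pdom q).
move: (xq); rewrite inE; case e: (q x) => [y|] // _.
by rewrite (perm_extensionE e); apply: in_prange e.
Qed.

Lemma perm_extension_inj : injective (perm_extension q).
Proof.
move=> x y e; have := perm_extension_prange x; rewrite e perm_extension_prange.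
have [yq|yq] := boolP (y \in pdom q) => /esym xq.
  move: xq yq e; rewrite !inE /perm_extension.
  case ex: (q x) => [a|] //; case ey: (q y) => [b|] //= _ _ eab.
  by apply: qI ex _; rewrite ey eab.
have {}xq : x \notin pdom q by rewrite xq.
have := perm_extension_index xq; rewrite e perm_extension_index // => /esym ei.
have: x \in enum (~: pdom q) by rewrite mem_enum inE.
by move/(nth_index x) => <-; rewrite ei nth_index // mem_enum inE.
Qed.

End Out.

(** Outside the domains only positions matter. The complement of [prange f] and that of [pdom g] are
    the same list, so a position passes unchanged through both extensions. *)
Lemma perm_extension_comp (f g h : pfun T) : pinjective f -> pinjective g ->
  prange f = pdom g -> h = Defs.pcomp g f ->
  perm_extension h =1 perm_extension g \o perm_extension f.
Proof.
move=> fI gI efg eh x /=.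
have domh : pdom h = pdom f.
  apply/setP=> z; rewrite !inE eh ffunE; case e: (f z) => [y|] //=.
  by have := in_prange e; rewrite efg inE.
have ranh : prange h = prange g.
  apply/setP=> z; apply/prangeP/prangeP => -[y].
    by rewrite eh ffunE; case: (f y) => //= a; exists a.
  move=> e; have := in_pdom e; rewrite -efg => /prangeP[w ew].
  by exists w; rewrite eh ffunE ew.
have [xf|xf] := boolP (x \in pdom f).
  move: xf; rewrite inE; case e: (f x) => [y|] // _.
  have := in_prange e; rewrite efg inE; case e': (g y) => [z|] // _.
  rewrite (perm_extensionE e) (perm_extensionE e') (@perm_extensionE h x z) //.
  by rewrite eh ffunE e.
have yg : perm_extension f x \notin pdom g by rewrite -efg perm_extension_prange.
rewrite [in RHS]/perm_extension (pdomPn yg) -efg perm_extension_index //.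
rewrite /perm_extension (pdomPn xf) pdomPn ?domh // ranh.
apply: set_nth_default; rewrite size_enum_out // -efg size_enum_out //.
by rewrite index_mem mem_enum inE.
Qed.

End PartialInjections.

(** * Labelled graphs and valuation covers *)

Section Systems.

Variables (A : finMetricSpace) (delta : nat).
Implicit Types f g h : pfun A.

Record coherent_triple f g h : Prop := CoherentTriple {
  ct_f : partial_automorphism f;
  ct_g : partial_automorphism g;
  ct_h : partial_automorphism h;
  ct_dom : pdom f = pdom h;
  ct_mid : prange f = pdom g;
  ct_comp : h = Defs.pcomp g f
}.

(* Labelled graph around [A], with [lab x y = 0] encoding a non-edge. *)
Record system := System {
  vtx :> finType;
  lab : vtx -> vtx -> nat;
  par : vtx -> bool;
  emb : A -> vtx;
  ext : pfun A -> vtx -> vtx;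
  lab_sym : forall x y, lab x y = lab y x;
  lab_irr : forall x, lab x x = 0;
  lab_le : forall x y, lab x y <= delta;
  lab_par : forall x y, 0 < lab x y -> odd (lab x y) = par x (+) par y;
  lab_emb : forall a b, lab (emb a) (emb b) = fdist a b;
  ext_inj : forall f, partial_automorphism f -> injective (ext f);
  ext_lab : forall f, partial_automorphism f ->
    forall x y, lab (ext f x) (ext f y) = lab x y;
  ext_par : forall f, partial_automorphism f ->
    forall x y, par (ext f x) (+) par (ext f y) = par x (+) par y;
  ext_emb : forall f, partial_automorphism f ->
    forall a b, f a = Some b -> ext f (emb a) = emb b;
  ext_comp : forall f g h, coherent_triple f g h -> ext h =1 ext g \o ext f
}.

Lemma emb_inj (B : system) : injective (@emb B).
Proof.
move=> a b e; apply/(metric_eq0 (@fdist_metric A)).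
by rewrite -(lab_emb B) e lab_irr.
Qed.

Lemma pauto_pinj f : partial_automorphism f -> pinjective f.
Proof.
move=> fP a b c ea eb; apply/(metric_eq0 (@fdist_metric A)).
by rewrite -(fP _ _ _ _ ea eb); apply/(metric_eq0 (@fdist_metric A)).
Qed.

Lemma ct_some f g h a c : coherent_triple f g h -> h a = Some c ->
  exists2 b, f a = Some b & g b = Some c.
Proof.
by case=> _ _ _ _ _ ->; rewrite ffunE; case: (f a) => //= b; exists b.
Qed.

Lemma ct_some1 f g h a b : coherent_triple f g h -> f a = Some b ->
  exists2 c, g b = Some c & h a = Some c.
Proof.
case=> _ _ _ _ efg -> e; have := in_prange e; rewrite efg inE ffunE e /=.
by case: (g b) => // c; exists c.
Qed.

(** * Covers by valuations of configurations *)

Section Cover.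

Variables (B : system) (T W : finType).
Variables (R : T -> B -> B -> W -> W -> bool).
Variables (tact : pfun A -> T -> T) (theta : pfun A -> T -> B -> W -> W).
Variable (v : A -> T -> W).
Hypothesis R_sym : forall C x y w w', R C x y w w' = R C y x w' w.
Hypothesis R_emb : forall C a b, a != b -> R C (emb B a) (emb B b) (v a C) (v b C).
Hypothesis tact_inj : forall f, partial_automorphism f -> injective (tact f).
Hypothesis tact_comp : forall f g h, coherent_triple f g h ->
  tact h =1 tact g \o tact f.
Hypothesis theta_inj : forall f C x, partial_automorphism f ->
  injective (theta f C x).
Hypothesis theta_R : forall f C x y w w', partial_automorphism f ->
  R (tact f C) (ext f x) (ext f y) (theta f C x w) (theta f C y w') =
  R C x y w w'.
Hypothesis theta_emb : forall f C a b, partial_automorphism f ->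
  f a = Some b -> theta f C (emb B a) (v a C) = v b (tact f C).
Hypothesis theta_comp : forall f g h C x w, coherent_triple f g h ->
  theta h C x w = theta g (tact f C) (ext f x) (theta f C x w).

Let V : finType := (B * {ffun T -> W})%type.
Implicit Types p q : V.

Definition cover_lab p q :=
  if [forall C, R C p.1 q.1 (p.2 C) (q.2 C)] then lab p.1 q.1 else 0.

(** The configurations move along with the vertices: the value at [tact f C] is computed from the
    old value at [C], hence the inverse of [tact f]. Later computations evaluate only at points
    [tact f C], where the inverse cancels. *)
Definition cover_ext f p : V :=
  (ext f p.1,
   [ffun C => theta f (finv (tact f) C) p.1 (p.2 (finv (tact f) C))]).

Definition cover_emb a : V := (emb B a, [ffun C => v a C]).

Lemma cover_extE f p C : partial_automorphism f ->
  (cover_ext f p).2 (tact f C) = theta f C p.1 (p.2 C).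
Proof. by move=> fP; rewrite ffunE (finv_f (tact_inj fP)). Qed.

Lemma cover_eq f p q : partial_automorphism f ->
  p.1 = q.1 -> (forall C, p.2 (tact f C) = q.2 (tact f C)) -> p = q.
Proof.
case: p q => [x p] [y q] /= fP -> e; congr (_, _); apply/ffunP=> C.
by rewrite -(f_finv (tact_inj fP) C) e.
Qed.

Definition valuation_cover : system.
Proof.
apply: (@System V cover_lab (fun p => par p.1) cover_emb cover_ext).
- move=> p q; rewrite /cover_lab lab_sym; congr (if _ then _ else _).
  by apply: eq_forallb => C; rewrite R_sym.
- by move=> p; rewrite /cover_lab lab_irr if_same.
- by move=> p q; rewrite /cover_lab; case: ifP => // _; apply: lab_le.
- by move=> p q; rewrite /cover_lab; case: ifP => // _; apply: lab_par.
- move=> a b; rewrite /cover_lab lab_emb; case: ifPn => // /forallPn /= [C].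
  rewrite !ffunE; case: (eqVneq a b) => [-> _|/R_emb->] //.
  by apply/esym/(metric_eq0 (@fdist_metric A)).
- move=> f fP p q e; have e1 : p.1 = q.1.
    by apply: (ext_inj fP); move: e => /(congr1 fst).
  apply: (@cover_eq f) => // C.
  have := congr1 (fun r : V => r.2 (tact f (tact f C))) e.
  by rewrite !cover_extE // -e1 => /theta_inj; apply.
- move=> f fP p q; rewrite /cover_lab /= ext_lab //; congr (if _ then _ else _).
  apply/forallP/forallP => /= RC C.
    by have := RC (tact f C); rewrite !cover_extE // theta_R.
  by rewrite -(f_finv (tact_inj fP) C) !cover_extE // theta_R.
- by move=> f fP p q; apply: ext_par.
- move=> f fP a b fab; apply: (@cover_eq f) => [//||C] /=.
    by apply: ext_emb.
  rewrite -[LHS]/((cover_ext f (cover_emb a)).2 _) cover_extE //= !ffunE.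
  exact: theta_emb.
- move=> f g h ct p; have [fP gP hP _ _ _] := ct.
  apply: (@cover_eq h) => [//||C] /=; first exact: ext_comp.
  rewrite -[LHS]/((cover_ext h p).2 _) cover_extE // (tact_comp ct) /=.
  rewrite -[RHS]/((cover_ext g (cover_ext f p)).2 _) !cover_extE //.
  exact: theta_comp.
Defined.

(** This is the interface used later: edges project to edges of the same label, and their ends carry
    compatible values for every configuration. *)
Lemma valuation_coverP :
  exists (B' : system) (pr : B' -> B) (val : B' -> T -> W),
  forall p q : B', 0 < lab p q ->
    lab p q = lab (pr p) (pr q) /\
    forall C, R C (pr p) (pr q) (val p C) (val q C).
Proof.
exists valuation_cover, fst, (fun p C => p.2 C) => p q.
rewrite {1 2}/lab /= /cover_lab; case: ifP => // /forallP RC _.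
by split.
Qed.

End Cover.

(** * The bipartite graph of valuations of pairs *)

Section Base.

Variable side : A -> bool.
Hypothesis side_odd : forall a b, odd (fdist a b) = side a (+) side b.
Hypothesis dist_le : forall a b : A, fdist a b <= delta.

Import GRing.Theory.
Local Open Scope ring_scope.

Let Z := 'I_delta.+1.
Let V : finType := (A * bool * {ffun A -> Z})%type.
Implicit Types p q : V.

(** The two ends share the label as a sum in the cyclic group of order [delta.+1], so opposite
    shifts at the two ends leave it unchanged. A sum equal to 0 gives a non-edge, as does a sum of
    the wrong parity. *)
Definition base_lab p q : nat :=
  let c : Z := p.2 q.1.1 + q.2 p.1.1 in
  if (p.1.1 != q.1.1) && (odd c == p.1.2 (+) q.1.2) then nat_of_ord c else 0%N.

(* Only one of the two ends of an edge carries its label, so that the two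
   valuations of the edge add up to it. *)
Definition base_val (a b : A) : Z :=
  if (enum_rank a < enum_rank b)%N then inord (fdist a b) else 0.

Definition base_emb a : V := (a, side a, [ffun b => base_val a b]).

(** A partial automorphism keeps the sides of all points of its domain or exchanges them all. The
    extension does the same to the whole graph, so only differences of [par] are invariant. *)
Definition swaps f := [exists a, exists b, (f a == Some b) && (side a (+) side b)].

(** At a point of the domain the shift is forced by the embedding of [A]. At a point outside, the
    shift compensates for the one imposed at the other end, and it is 0 if neither end is in the
    domain. *)
Definition base_shift f (a b : A) : Z :=
  let pi := perm_extension f in
  if a \in pdom f then base_val (pi a) (pi b) - base_val a b
  else if b \in pdom f then base_val b a - base_val (pi b) (pi a) else 0.

Definition base_ext f p : V :=
  let pi := perm_extension f in
  (pi p.1.1, p.1.2 (+) swaps f,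
   [ffun b => p.2 (finv pi b) + base_shift f p.1.1 (finv pi b)]).

Lemma side_some f a b a' b' : partial_automorphism f ->
  f a = Some a' -> f b = Some b' -> side a (+) side a' = side b (+) side b'.
Proof.
move=> fP ea eb; have := fP _ _ _ _ ea eb => /(congr1 odd); rewrite !side_odd.
by case: (side a) (side b) (side a') (side b') => [] [] [] [].
Qed.

Lemma swapsE f a b : partial_automorphism f -> f a = Some b ->
  swaps f = side a (+) side b.
Proof.
move=> fP e; apply/existsP/idP => [[a' /existsP[b' /andP[/eqP e' s]]]|s].
  by rewrite (side_some fP e e').
by exists a; apply/existsP; exists b; rewrite e eqxx.
Qed.

Lemma swaps_none f : (forall a, f a = None) -> swaps f = false.
Proof.
by move=> e; apply/existsP => -[a /existsP[b]]; rewrite e.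
Qed.

Lemma base_val_sum a b : a != b -> base_val a b + base_val b a = inord (fdist a b).
Proof.
move=> ab; have: enum_rank a != enum_rank b :> nat.
  by apply: contraNneq ab => /ord_inj/enum_rank_inj->.
rewrite /base_val (metric_sym (@fdist_metric A) b a).
by case: ltngtP => // _ _; rewrite ?addr0 ?add0r.
Qed.

(** The only case with content has both points in the domain: the shares of a pair add up to its
    distance, which [f] preserves, so the two changes cancel. *)
Lemma base_shift_anti f a b : partial_automorphism f -> a != b ->
  base_shift f a b = - base_shift f b a.
Proof.
move=> fP ab; rewrite /base_shift.
have [af|af] := boolP (a \in pdom f); have [bf|bf] := boolP (b \in pdom f);
  rewrite ?oppr0 ?opprB //.
move: af bf; rewrite !inE; case ea: (f a) => [a'|] //; case eb: (f b) => [b'|] // _ _.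
have ab' : a' != b'.
  apply: contraNneq ab => e; apply/eqP; apply: (pauto_pinj fP) ea _.
  by rewrite eb e.
have := base_val_sum ab'; rewrite (fP _ _ _ _ ea eb) -(base_val_sum ab).
rewrite (perm_extensionE ea) (perm_extensionE eb) => e.
by apply/eqP; rewrite subr_eq addrAC eq_sym subr_eq e addrC.
Qed.

Lemma base_extE f p b : partial_automorphism f ->
  (base_ext f p).2 (perm_extension f b) = p.2 b + base_shift f p.1.1 b.
Proof.
by move=> fP; rewrite ffunE finv_f //; apply/perm_extension_inj/pauto_pinj.
Qed.

Lemma base_eq f p q : partial_automorphism f -> p.1 = q.1 ->
  (forall b, p.2 (perm_extension f b) = q.2 (perm_extension f b)) -> p = q.
Proof.
case: p q => [x p] [y q] /= fP -> e; congr (_, _); apply/ffunP=> b.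
by rewrite -(f_finv (perm_extension_inj (pauto_pinj fP)) b) e.
Qed.

Lemma base_shift_comp f g h a b : coherent_triple f g h ->
  base_shift h a b = base_shift f a b +
    base_shift g (perm_extension f a) (perm_extension f b).
Proof.
move=> ct; have [fP gP hP edom emid ecomp] := ct.
have fI := pauto_pinj fP; have gI := pauto_pinj gP.
rewrite /base_shift -edom -emid !perm_extension_prange //.
rewrite !(perm_extension_comp fI gI emid ecomp) /=.
case: ifP => _; first by rewrite [RHS]addrC addrA subrK.
by case: ifP => _; rewrite ?addr0 // addrA subrK.
Qed.

Definition base : system.
Proof.
apply: (@System V base_lab (fun p => p.1.2) base_emb base_ext).
- move=> p q; rewrite /base_lab eq_sym [q.2 _ + _]addrC.
  by rewrite [q.1.2 (+) _]addbC.
- by move=> p; rewrite /base_lab eqxx.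
- by move=> p q; rewrite /base_lab; case: ifP => // _; rewrite -ltnS ltn_ord.
- by move=> p q; rewrite /base_lab; case: ifP => // /andP[_ /eqP].
- move=> a b; case: (eqVneq a b) => [->|ab].
    by rewrite /base_lab eqxx; apply/esym/(metric_eq0 (@fdist_metric A)).
  rewrite /base_lab -[(base_emb a).1.1]/a -[(base_emb b).1.1]/b !ffunE.
  by rewrite base_val_sum // inordK ?ltnS // side_odd eqxx ab.
- move=> f fP p q e.
  have e1 : p.1 = q.1.
    case: p q e => [[x s] p] [[y t] q] /= [/perm_extension_inj->].
      by move/addIb->.
    exact: pauto_pinj.
  apply: (@base_eq f) => // b.
  have := congr1 (fun r : V => r.2 (perm_extension f (perm_extension f b))) e.
  by rewrite !base_extE // -e1 => /addIr.
- move=> f fP p q; rewrite /base_lab !base_extE //.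
  rewrite (inj_eq (perm_extension_inj (pauto_pinj fP))).
  rewrite addbACA addbb addbF.
  case: (eqVneq p.1.1 q.1.1) => [//|/(base_shift_anti fP) ->].
  by rewrite addrACA addNr addr0.
- by move=> f fP p q /=; rewrite addbACA addbb addbF.
- move=> f fP a b e; apply: (@base_eq f) => [//||c] /=.
    rewrite (swapsE fP e) (perm_extensionE e).
    by rewrite addbA addbb.
  rewrite -[LHS]/((base_ext f (base_emb a)).2 _) base_extE //= !ffunE.
  rewrite /base_shift (in_pdom e) (perm_extensionE e).
  by rewrite addrC subrK.
- move=> f g h ct p; have [fP gP hP edom emid ecomp] := ct.
  have fI := pauto_pinj fP; have gI := pauto_pinj gP.
  have piE := perm_extension_comp fI gI emid ecomp.
  apply: (@base_eq h) => [//||b] /=.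
    rewrite piE; congr (_, _).
    rewrite -addbA; congr (_ (+) _).
    (* One point in the domain of [h] determines all three swaps. If there is none, all three maps
       are empty and swap nothing. *)
    case: (pickP [pred a | h a != None]) => [a /=|hN].
      case e: (h a) => [c|] // _; have [b eb ec] := ct_some ct e.
      rewrite (swapsE hP e) (swapsE fP eb) (swapsE gP ec).
      by case: (side a) (side b) (side c) => [] [] [].
    have hN' a : h a = None by have /eqP := hN a.
    have fN a : f a = None.
      case e: (f a) => [c|] //.
      by have [c' _ eh] := ct_some1 ct e; rewrite hN' in eh.
    have gN a : g a = None.
      case e: (g a) => [c|] //; have := in_pdom e; rewrite -emid => /prangeP[b].
      by rewrite fN.
    by rewrite !swaps_none.
  rewrite -[LHS]/((base_ext h p).2 _) base_extE // piE /=.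
  rewrite -[RHS]/((base_ext g (base_ext f p)).2 _) !base_extE //.
  by rewrite (base_shift_comp _ _ ct) addrA.
Defined.

End Base.

End Systems.

(** * Removing large cliques *)

Definition clique (T : finType) (d : T -> T -> nat) (k : nat) (X : {set T}) :=
  [forall x in X, forall y in X, (x != y) ==> (d x y == k)].

Lemma cliqueP (T : finType) (d : T -> T -> nat) (k : nat) (X : {set T}) :
  reflect {in X &, forall x y, x != y -> d x y = k} (clique d k X).
Proof.
apply: (iffP idP) => [cX x y xX yX xy|cX].
  apply/eqP; move: cX => /forallP/(_ x)/implyP/(_ xX).
  by move=> /forallP/(_ y)/implyP/(_ yX)/implyP; apply.
apply/forallP=> x; apply/implyP=> xX; apply/forallP=> y; apply/implyP=> yX.
by apply/implyP=> xy; rewrite cX.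
Qed.

Section CliqueCover.

Variables (A : finMetricSpace) (delta K : nat) (B : system A delta).
Hypothesis delta_gt0 : 0 < delta.
Hypothesis cliqueA : forall X : {set A}, clique (@fdist A) delta X -> #|X| <= K.+1.
Implicit Types (f g h : pfun A) (X : {set B}).

Definition big_clique X := (K.+1 < #|X|) && clique (@lab _ _ B) delta X.

Definition trace X := enum [set a | emb B a \in X].

(** Numbers the points of [A] on a big clique. They form a [delta]-clique of [A], so [K.+1] ranks
    suffice to keep them distinct. The value [ord0] elsewhere is a default. *)
Definition rank_in (a : A) X : 'I_K.+1 :=
  if big_clique X && (emb B a \in X) then inord (index a (trace X)) else ord0.

Lemma mem_trace a X : (a \in trace X) = (emb B a \in X).
Proof. by rewrite mem_enum inE. Qed.

Lemma size_trace X : big_clique X -> size (trace X) <= K.+1.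
Proof.
move=> /andP[_ /cliqueP cX]; rewrite /trace -cardE; apply/cliqueA/cliqueP=> a b.
rewrite !inE => aX bX ab; rewrite -(lab_emb B); apply: cX => //.
by rewrite (inj_eq (@emb_inj _ _ B)).
Qed.

Lemma rank_in_inj X a b : big_clique X -> emb B a \in X -> emb B b \in X ->
  rank_in a X = rank_in b X -> a = b.
Proof.
move=> bX aX bX' /(congr1 (@nat_of_ord _)); have sX := size_trace bX.
rewrite /rank_in bX aX bX' /=.
rewrite !inordK; first last.
- by apply: leq_trans sX; rewrite index_mem mem_trace.
- by apply: leq_trans sX; rewrite index_mem mem_trace.
by move=> e; rewrite -(nth_index a (s := trace X) (x := a)) ?mem_trace // e
  nth_index ?mem_trace.
Qed.

Lemma mem_ext_set f x X : partial_automorphism f ->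
  (ext f x \in ext f @: X) = (x \in X).
Proof. by move=> fP; rewrite mem_imset //; apply: ext_inj. Qed.

Lemma big_clique_ext f X : partial_automorphism f ->
  big_clique (ext f @: X) = big_clique X.
Proof.
move=> fP; have fI := ext_inj (s := B) fP; rewrite /big_clique card_imset //.
congr (_ && _); apply/cliqueP/cliqueP => cX x y.
  move=> xX yX xy; rewrite -(ext_lab fP) cX ?mem_imset //.
  by rewrite (inj_eq fI).
move=> /imsetP[x' xX ->] /imsetP[y' yX ->]; rewrite (inj_eq fI) => xy.
by rewrite ext_lab // cX.
Qed.

(** The partial map that [f] induces from ranks on [X] to ranks on its image. On a big clique the
    picked point is unique, as ranks are injective there. *)
Definition rank_pfun f X : pfun 'I_K.+1 :=
  [ffun w => if [pick a | [&& isSome (f a), emb B a \in X & rank_in a X == w]]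
             is Some a then omap (rank_in ^~ (ext f @: X)) (f a) else None].

Lemma rank_pfunE f X a b : partial_automorphism f -> big_clique X ->
  f a = Some b -> emb B a \in X ->
  rank_pfun f X (rank_in a X) = Some (rank_in b (ext f @: X)).
Proof.
move=> fP bX fab aX; rewrite ffunE; case: pickP => [a'|/(_ a)]; last first.
  by rewrite fab aX eqxx.
move=> /and3P[_ aX' /eqP e].
by rewrite (rank_in_inj bX aX' aX e) fab.
Qed.

Lemma rank_pfun_some f X w w' : rank_pfun f X w = Some w' ->
  exists a b, [/\ f a = Some b, emb B a \in X, rank_in a X = w &
    rank_in b (ext f @: X) = w'].
Proof.
rewrite ffunE; case: pickP => // a /and3P[]; case e: (f a) => [b|] // _ aX.
by move=> /eqP ew [ew']; exists a, b.
Qed.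

Lemma rank_pfun_pinj f X : partial_automorphism f -> big_clique X ->
  pinjective (rank_pfun f X).
Proof.
move=> fP bX w1 w2 w /rank_pfun_some[a [a' [ea aX <- ew]]].
move=> /rank_pfun_some[b [b' [eb bX' <- ew']]]; congr rank_in.
have /(_ a' b') := @rank_in_inj (ext f @: X).
rewrite big_clique_ext // -(ext_emb B fP ea) -(ext_emb B fP eb) !mem_ext_set //.
by rewrite ew ew' => /(_ bX aX bX' erefl) e; apply: (pauto_pinj fP) ea _; rewrite eb e.
Qed.

Lemma ext_set_comp f g h X : coherent_triple f g h ->
  ext h @: X = ext g @: (ext f @: X).
Proof.
move=> ct; rewrite -imset_comp; apply: eq_imset => x.
exact: ext_comp.
Qed.

Lemma rank_pfun_mid f g h X : coherent_triple f g h -> big_clique X ->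
  prange (rank_pfun f X) = pdom (rank_pfun g (ext f @: X)).
Proof.
move=> ct bX; have [fP gP _ _ emid _] := ct; apply/setP=> w.
have bX' : big_clique (ext f @: X) by rewrite big_clique_ext.
apply/prangeP/idP => [[w0 /rank_pfun_some[a [b [ea aX _ <-]]]]|].
  have [c eb _] := ct_some1 ct ea.
  apply: in_pdom (rank_pfunE gP bX' eb _).
  by rewrite -(ext_emb B fP ea) mem_ext_set.
rewrite inE; case e: (rank_pfun _ _ _) => [w'|] // _.
have [b [c [eb bX'' <- _]]] := rank_pfun_some e.
have := in_pdom eb; rewrite -emid => /prangeP[a ea].
exists (rank_in a X); apply: rank_pfunE => //.
by move: bX''; rewrite -(ext_emb B fP ea) mem_ext_set.
Qed.

Lemma rank_pfun_comp f g h X : coherent_triple f g h -> big_clique X ->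
  rank_pfun h X = Defs.pcomp (rank_pfun g (ext f @: X)) (rank_pfun f X).
Proof.
move=> ct bX; have [fP gP hP _ emid _] := ct; apply/ffunP=> w; rewrite [RHS]ffunE.
have bX' : big_clique (ext f @: X) by rewrite big_clique_ext.
case e: (rank_pfun f X w) => [w'|] /=.
  have [a [b [ea aX <- <-]]] := rank_pfun_some e.
  have [c eb ec] := ct_some1 ct ea.
  rewrite (rank_pfunE hP bX ec aX) (rank_pfunE gP bX' eb) ?(ext_set_comp _ ct) //.
  by rewrite -(ext_emb B fP ea) mem_ext_set.
case e': (rank_pfun h X w) => [w'|] //.
have [a [c [ea aX ew _]]] := rank_pfun_some e'.
have [b eb _] := ct_some ct ea.
by have := rank_pfunE fP bX eb aX; rewrite ew e.
Qed.

Definition clique_rel X x y (w w' : 'I_K.+1) :=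
  [&& big_clique X, x \in X, y \in X & x != y] ==> (w != w').

(** All vertices of the clique use the same permutation of values, so distinct values stay
    distinct. *)
Definition clique_theta f X x : 'I_K.+1 -> 'I_K.+1 :=
  if big_clique X && (x \in X) then perm_extension (rank_pfun f X) else id.

(* A clique with more than [K.+1] points cannot be lifted: its lifts would have
   pairwise distinct valuations in ['I_K.+1]. *)
Lemma clique_cover : exists B' : system A delta,
  forall X : {set B'}, clique (@lab _ _ B') delta X -> #|X| <= K.+1.
Proof.
have RS X x y w w' : clique_rel X x y w w' = clique_rel X y x w' w.
  rewrite /clique_rel [y == x]eq_sym [w' == w]eq_sym.
  by case: (x \in X) (y \in X) => [] [].
have RE X a b : a != b ->
    clique_rel X (emb B a) (emb B b) (rank_in a X) (rank_in b X).
  move=> ab; apply/implyP=> /and4P[bX aX bX' _]; apply: contraNneq ab.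
  by move=> /rank_in_inj->.
have TC f g h : coherent_triple f g h ->
    (fun X => ext h @: X) =1 (fun X => ext g @: X) \o (fun X => ext f @: X).
  by move=> ct X; apply: ext_set_comp.
have TI f : partial_automorphism f ->
    injective (fun X : {set B} => ext f @: X).
  by move=> fP; apply/imset_inj/ext_inj.
have thI f X x : partial_automorphism f -> injective (clique_theta f X x).
  move=> fP; rewrite /clique_theta; case: ifP => [/andP[bX _]|_ w w' //].
  exact/perm_extension_inj/rank_pfun_pinj.
have thR f X x y w w' : partial_automorphism f ->
    clique_rel (ext f @: X) (ext f x) (ext f y)
      (clique_theta f X x w) (clique_theta f X y w') = clique_rel X x y w w'.
  move=> fP; rewrite /clique_rel big_clique_ext // !mem_ext_set //.
  rewrite (inj_eq (ext_inj fP)) /clique_theta.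
  case bX: (big_clique X) => //=; case: (x \in X) => //; case: (y \in X) => //=.
  by rewrite (inj_eq (perm_extension_inj (rank_pfun_pinj fP bX))).
have thE f X a b : partial_automorphism f -> f a = Some b ->
    clique_theta f X (emb B a) (rank_in a X) = rank_in b (ext f @: X).
  move=> fP fab; rewrite /clique_theta; case: ifP => [/andP[bX aX]|].
    exact/perm_extensionE/rank_pfunE.
  by rewrite /rank_in -(ext_emb B fP fab) big_clique_ext // mem_ext_set // => ->.
have thC f g h X x w : coherent_triple f g h ->
    clique_theta h X x w =
    clique_theta g (ext f @: X) (ext f x) (clique_theta f X x w).
  move=> ct; have [fP gP _ _ _ _] := ct; rewrite /clique_theta.
  rewrite big_clique_ext // mem_ext_set //; case: ifP => // /andP[bX _].
  apply: perm_extension_comp; [exact: rank_pfun_pinj| |exact: rank_pfun_mid ct _|].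
    by apply: rank_pfun_pinj; rewrite ?big_clique_ext.
  exact: rank_pfun_comp.
have [B' [pr [val labP]]] := valuation_coverP RS RE TI TC thI thR thE thC.
exists B' => X /cliqueP cX; rewrite leqNgt; apply/negP=> KX.
have labX p q : p \in X -> q \in X -> p != q ->
    lab (pr p) (pr q) = delta /\
    forall C, clique_rel C (pr p) (pr q) (val p C) (val q C).
  by move=> pX qX pq; have [|<-] := labP p q; rewrite cX.
have prI : {in X &, injective pr}.
  move=> p q pX qX e; apply: contraTeq delta_gt0 => /(labX _ _ pX qX) [+ _].
  by rewrite e lab_irr => <-.
(* The projection of an oversized clique is itself one of the configurations. The values at this
   configuration separate the points of [X]. *)
pose Y := pr @: X.
have bY : big_clique Y.
  rewrite /big_clique card_in_imset // KX; apply/cliqueP.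
  move=> _ _ /imsetP[p pX ->] /imsetP[q qX ->] pq.
  by have [|] := labX _ _ pX qX; first by apply: contraNneq pq => ->.
have valI : {in X &, injective (val ^~ Y)}.
  move=> p q pX qX /= e; apply/eqP; rewrite -[_ == _]negbK; apply/negP=> pq.
  have [_ /(_ Y)] := labX _ _ pX qX pq; rewrite /clique_rel e eqxx implybF.
  rewrite bY !imset_f //= negbK => /eqP /(prI _ _ pX qX) epq.
  by rewrite epq eqxx in pq.
have := max_card [set val p Y | p in X].
by rewrite card_in_imset // card_ord leqNgt KX.
Qed.

End CliqueCover.

(** * Walks in the double cover *)

Section Walks.

Variables (A : finMetricSpace) (delta u : nat) (B : system A delta).
Hypothesis delta_lt : delta < u.

(* Points of the antipodal double cover of [B]. *)
Local Notation dpt := (B * bool)%type.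
Implicit Types (P Q Z : dpt) (s : seq dpt).

Definition flip P : dpt := (P.1, ~~ P.2).

Definition wt P Q : nat :=
  if lab P.1 Q.1 == 0 then 0
  else if P.2 == Q.2 then lab P.1 Q.1 else u - lab P.1 Q.1.

Definition adj P Q := 0 < lab P.1 Q.1.

Fixpoint weight P s : nat :=
  if s is Q :: s' then wt P Q + weight Q s' else 0.

Lemma flipK P : flip (flip P) = P.
Proof. by case: P => x b; rewrite /flip negbK. Qed.

Lemma flip_or P Q : P.1 = Q.1 -> Q = P \/ Q = flip P.
Proof.
case: P Q => [x b] [y c] /= ->; rewrite /flip /=.
by case: b c => [] []; [left|right|right|left].
Qed.

Lemma wt_gt0 P Q : adj P Q -> 0 < wt P Q.
Proof.
rewrite /adj /wt; have := lab_le P.1 Q.1.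
by case: ifP => [|_]; [|case: ifP => _]; lia.
Qed.

Lemma wt_sym P Q : wt P Q = wt Q P.
Proof. by rewrite /wt lab_sym [P.2 == _]eq_sym. Qed.

Lemma wt_flip P Q : adj P Q -> wt P (flip Q) = u - wt P Q.
Proof.
rewrite /adj /wt /=; have := lab_le P.1 Q.1; case: ifP => [|_]; first lia.
by case: P.2 Q.2 => [] []; rewrite /=; lia.
Qed.

Lemma wt_le P Q : wt P Q <= u.
Proof.
rewrite /wt; have := lab_le P.1 Q.1.
by case: ifP => [|_]; [|case: ifP => _]; lia.
Qed.

Lemma wt_flip2 P Q : wt (flip P) (flip Q) = wt P Q.
Proof. by rewrite /wt /=; case: P.2 Q.2 => [] []. Qed.

Lemma weight_cat P s1 s2 :
  weight P (s1 ++ s2) = weight P s1 + weight (last P s1) s2.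
Proof. by elim: s1 P => //= Q s1 IH P; rewrite IH addnA. Qed.

Lemma weight_rcons P s Q : weight P (rcons s Q) = weight P s + wt (last P s) Q.
Proof. by rewrite -cats1 weight_cat /= addn0. Qed.

Lemma size_le_weight P s : path adj P s -> size s <= weight P s.
Proof.
elim: s P => //= Q s IH P /andP[/wt_gt0 PQ /IH]; lia.
Qed.

Definition no_short_walk n := forall P s,
  path adj P s -> last P s = flip P -> size s <= n -> u <= weight P s.

(** Two steps go from [P] to some [Q] and on to [flip P], and these two weights are complementary
    with sum exactly [u]. *)
Lemma no_short_walk2 : no_short_walk 2.
Proof.
move=> P [|Q [|Z [|//]]] /=.
- by case: P => x [].
- by rewrite /adj andbT => + e; rewrite e lab_irr.
- rewrite andbT => /andP[PQ _] -> _; rewrite addn0 [wt Q _]wt_sym.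
  have := wt_flip PQ; rewrite -wt_flip2 flipK => ->.
  by have := wt_le P Q; lia.
Qed.

(** The list [s] holds the intermediate vertices only, so the walk has one step more than [s] has
    entries. *)
Definition bad_walk P s :=
  path adj P (rcons s (flip P)) && (weight P (rcons s (flip P)) < u).

(** * Minimal bad walks *)

Section Minimal.

Variables (n : nat) (P Q : dpt) (s1 s2 : seq dpt).
Hypothesis shortP : no_short_walk n.
Hypothesis size_s : size (s1 ++ Q :: s2) <= n.
Hypothesis badP : bad_walk P (s1 ++ Q :: s2).

Let s1P : path adj P (rcons s1 Q).
Proof.
by case/andP: badP; rewrite rcons_cat rcons_cons -cat_rcons cat_path => /andP[].
Qed.

Let s2P : path adj Q (rcons s2 (flip P)).
Proof.
case/andP: badP; rewrite rcons_cat rcons_cons -cat_rcons cat_path last_rcons.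
by case/andP.
Qed.

Let s12_weight : weight P (rcons s1 Q) + weight Q (rcons s2 (flip P)) < u.
Proof.
case/andP: badP; rewrite rcons_cat rcons_cons -cat_rcons weight_cat last_rcons.
by [].
Qed.

Let s12_size : size s1 + (size s2).+1 <= n.
Proof. by move: size_s; rewrite size_cat. Qed.

(** If [Q] is [P], the part after it is a lighter and shorter walk from [P] to [flip P]. If [Q] is
    [flip P], the part before it is. *)
Lemma bad_walk_neq_first : Q.1 != P.1.
Proof.
apply/eqP=> /esym/flip_or[] e.
  have := shortP s2P; rewrite last_rcons size_rcons -e => /(_ erefl).
  have := s12_weight; rewrite e; lia.
have := shortP s1P; rewrite last_rcons size_rcons => /(_ e).
by have := s12_weight; lia.
Qed.

Hypothesis s2_neq0 : 0 < size s2.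
Let Z := last Q s2.

Let s2Z : path adj Q s2 /\ adj Z (flip P).
Proof. by move: s2P; rewrite rcons_path => /andP[]. Qed.

Let s2_weight : weight Q (rcons s2 (flip P)) = weight Q s2 + wt Z (flip P).
Proof. exact: weight_rcons. Qed.

(** If [Z] is [Q], the detour [s2] can be cut out. If [Z] is [flip Q], then [s2] is itself a shorter
    bad walk. *)
Lemma bad_walk_neq_last : Q.1 != Z.1.
Proof.
apply/eqP=> /flip_or[] e.
  have p1 : path adj P (rcons (rcons s1 Q) (flip P)).
    by rewrite rcons_path s1P last_rcons -e; case: s2Z.
  have := shortP p1; rewrite last_rcons !size_rcons weight_rcons last_rcons.
  by move=> /(_ erefl); have := s12_weight; rewrite s2_weight e; lia.
have [p2 _] := s2Z; have := shortP p2 e.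
by have := s12_weight; rewrite s2_weight; lia.
Qed.

Hypothesis triangleA : forall a b c : A, a != b -> b != c -> a != c ->
  fdist a b + fdist b c + fdist a c <= u.*2.

(* The two arcs cut off by a chord are at least as long as the chord, so a bad
   walk through three points of [A] would give a bad triangle of [A]. *)
Lemma bad_walk_no_triple a b c :
  P.1 = emb B a -> Q.1 = emb B b -> Z.1 = emb B c -> False.
Proof.
move=> ea eb ec; have [p2 ZP] := s2Z.
have fd0 x y : (fdist x y == 0) = (x == y :> A).
  by apply/eqP/eqP => /(metric_eq0 (@fdist_metric A)).
have ab : a != b.
  by have := bad_walk_neq_first; rewrite eq_sym ea eb (inj_eq (@emb_inj _ _ B)).
have bc : b != c.
  by have := bad_walk_neq_last; rewrite ec eb (inj_eq (@emb_inj _ _ B)).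
have ac : a != c.
  apply: contraTneq ZP => e; rewrite /adj /= ea ec e lab_irr //.
have PQ : adj P Q by rewrite /adj ea eb lab_emb lt0n fd0.
have QZ : adj Q Z by rewrite /adj ec eb lab_emb lt0n fd0.
(* An arc lighter than its chord, closed by the edge from [Q] to [flip P] of weight [u - wt P Q],
   would be a bad walk with fewer steps. *)
have w1 : wt P Q <= weight P (rcons s1 Q).
  rewrite leqNgt; apply/negP=> lt1.
  have p1 : path adj P (rcons (rcons s1 Q) (flip P)).
    by rewrite rcons_path s1P last_rcons /adj lab_sym.
  have := shortP p1; rewrite last_rcons !size_rcons weight_rcons last_rcons.
  move=> /(_ erefl); rewrite [wt Q _]wt_sym -wt_flip2 flipK wt_flip //.
  by have := wt_le P Q; have := s12_size; clear -lt1 s2_neq0; lia.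
have w2 : wt Q Z <= weight Q s2.
  rewrite leqNgt; apply/negP=> lt2.
  have p3 : path adj Q (rcons s2 (flip Q)).
    by rewrite rcons_path p2 /adj -/Z /= lab_sym.
  have := shortP p3; rewrite last_rcons !size_rcons weight_rcons -/Z.
  move=> /(_ erefl); rewrite [wt Z _]wt_sym -wt_flip2 flipK wt_flip //.
  by have := wt_le Q Z; have := s12_size; clear -lt2; lia.
have: wt P Q + wt Q Z + wt Z (flip P) < u.
  by have := s12_weight; rewrite s2_weight; clear -w1 w2; lia.
have tri := metric_triangle (@fdist_metric A).
have sym := metric_sym (@fdist_metric A).
(* Up to a global flip there are four sign patterns. Three contradict a triangle inequality of [A].
   In the fourth, all three weights are complements, and the perimeter exceeds [u.*2]. *)
have tA := triangleA ab bc ac; clear -delta_lt ea eb ec ab bc ac tA tri sym fd0; move: tA.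
have := tri a b c; have := tri b c a; have := tri b a c.
have := lab_le P.1 Q.1; have := lab_le Q.1 Z.1; have := lab_le Z.1 P.1.
rewrite /wt /= ea eb ec !lab_emb !fd0 (negbTE ab) (negbTE bc) [c == a]eq_sym.
rewrite (negbTE ac) (sym c a) (sym b a).
by case: P.2 Q.2 Z.2 => [] [] [] /=; lia.
Qed.

End Minimal.

End Walks.

(** * Removing short bad walks *)

Section WalkCover.

Variables (A : finMetricSpace) (delta u : nat) (B : system A delta) (n : nat).
Hypothesis delta_lt : delta < u.
Hypothesis n_gt1 : 1 < n.
Hypothesis triangleA : forall a b c : A, a != b -> b != c -> a != c ->
  fdist a b + fdist b c + fdist a c <= u.*2.
Hypothesis shortB : no_short_walk u B n.

Implicit Types (f g h : pfun A) (x y : B).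

Local Notation D := (B * bool)%type.
(** A configuration is a start and the [n] vertices after it. With the final step to the flip of the
    start, the walk has [n.+1] steps, the first length not covered by [shortB]. *)
Let T : finType := (D * n.-tuple D)%type.
Implicit Types C : T.

Definition bad C := bad_walk u C.1 C.2.
Definition first_vtx C : B := C.1.1.
Definition last_vtx C : B := (last C.1 C.2).1.
Definition vtxs C : seq B := map fst (C.1 :: C.2).

(** The last step ends at the flip of the start, which lies over the first vertex. In [B] it is thus
    the edge between the last and first vertices, taken here without orientation. *)
Definition closing C x y :=
  (x == first_vtx C) && (y == last_vtx C) ||
  (x == last_vtx C) && (y == first_vtx C).

Definition dext f (P : D) : D := (ext f P.1, P.2).
Definition walk_ext f C : T := (dext f C.1, [tuple of map (dext f) C.2]).

Section Ext.

Variables (f : pfun A) (fP : partial_automorphism f).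

Lemma dext_inj : injective (dext f).
Proof. by case=> [x b] [y c] [/(ext_inj fP)-> ->]. Qed.

Lemma weight_dext (P : D) (s : seq D) :
  weight u (dext f P) (map (dext f) s) = weight u P s.
Proof. by elim: s P => //= Q s IH P; rewrite IH /wt /= !ext_lab. Qed.

Lemma adj_dext (P Q : D) : adj (dext f P) (dext f Q) = adj P Q.
Proof. by rewrite /adj /= ext_lab. Qed.

Lemma bad_ext C : bad (walk_ext f C) = bad C.
Proof.
rewrite /bad /bad_walk /=.
have -> : rcons (map (dext f) C.2) (flip (dext f C.1)) =
  map (dext f) (rcons C.2 (flip C.1)) by rewrite map_rcons.
by rewrite weight_dext path_map; congr (_ && _); apply: eq_path => P Q; apply: adj_dext.
Qed.

Lemma first_vtx_ext C : first_vtx (walk_ext f C) = ext f (first_vtx C).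
Proof. by []. Qed.

Lemma last_vtx_ext C : last_vtx (walk_ext f C) = ext f (last_vtx C).
Proof. by rewrite /last_vtx /= last_map. Qed.

Lemma vtxs_ext C : vtxs (walk_ext f C) = map (ext f) (vtxs C).
Proof. by rewrite /vtxs /= -!map_comp. Qed.

Lemma mem_vtxs_ext C x : (ext f x \in vtxs (walk_ext f C)) = (x \in vtxs C).
Proof. by rewrite vtxs_ext mem_map //; apply: ext_inj. Qed.

Lemma closing_ext C x y :
  closing (walk_ext f C) (ext f x) (ext f y) = closing C x y.
Proof.
by rewrite /closing first_vtx_ext last_vtx_ext !(inj_eq (ext_inj fP)).
Qed.

Lemma walk_ext_inj : injective (walk_ext f).
Proof.
case=> [P s] [Q t] [/(ext_inj fP) e1 e2 es]; congr (_, _).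
  by case: P Q e1 e2 => [x b] [y c] /= -> ->.
exact/val_inj/(inj_map dext_inj).
Qed.

End Ext.

Lemma walk_ext_comp f g h : coherent_triple f g h ->
  walk_ext h =1 walk_ext g \o walk_ext f.
Proof.
move=> ct C; have e P : dext h P = dext g (dext f P).
  by rewrite /dext (ext_comp ct).
rewrite /walk_ext /= e; congr (_, _); apply: val_inj => /=.
by rewrite -map_comp; apply: eq_map.
Qed.

Lemma first_in C : first_vtx C \in vtxs C.
Proof. exact: mem_head. Qed.

Lemma closing_sym C x y : closing C x y = closing C y x.
Proof. by rewrite /closing orbC andbC [X in _ || X]andbC. Qed.

Lemma bad_third C a b c : bad C ->
  emb B a = first_vtx C -> emb B c = last_vtx C -> emb B b \in vtxs C ->
  b = a \/ b = c.
Proof.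
case: C => P s; rewrite /first_vtx /last_vtx /= => bC ea ec.
rewrite /vtxs /= inE => /orP[/eqP e|].
  by left; apply: (@emb_inj _ _ B); rewrite e.
move=> /mapP[Q Qs eb].
have [s1 [s2 defs]] : exists s1 s2, tval s = s1 ++ Q :: s2.
  by case/splitPr: Qs => s1 s2; exists s1, s2.
have [s20|s20] := posnP (size s2).
  right; apply: (@emb_inj _ _ B); rewrite ec eb.
  by rewrite defs (size0nil s20) last_cat.
exfalso; apply: (@bad_walk_no_triple _ _ u B delta_lt n P Q s1 s2 _ _ _ _ _ a b c) => //.
- by rewrite -defs size_tuple.
- by rewrite -defs.
- by rewrite ec defs last_cat.
Qed.

(* Exactly one end of the closing edge gets valuation [true], provided that
   both ends lie in [A]. *)
Definition walk_val (a : A) C :=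
  [&& bad C, emb B a == first_vtx C & [exists c, emb B c == last_vtx C]].

Definition walk_rel C x y (w w' : bool) :=
  [&& bad C, x \in vtxs C & y \in vtxs C] ==> (w (+) w' == closing C x y).

(** If both ends of the closing edge lie in [A], then [bad_third] leaves only these two points, and
    exactly one is marked. Otherwise both sides are false. *)
Lemma walk_val_closing C a b : a != b -> bad C ->
  emb B a \in vtxs C -> emb B b \in vtxs C ->
  walk_val a C (+) walk_val b C = closing C (emb B a) (emb B b).
Proof.
move=> ab bC aC bC'; rewrite /walk_val /closing bC /=.
have eI := inj_eq (@emb_inj _ _ B).
case: existsP => [[c /eqP ec]|noc]; last first.
  have nl d : (emb B d == last_vtx C) = false.
    by apply/negP=> e; apply: noc; exists d.
  by rewrite !nl !andbF.
rewrite !andbT -ec !eI.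
case: (eqVneq (emb B a) (first_vtx C)) => [ea|na] /=.
  have /negbTE nb : emb B b != first_vtx C by rewrite -ea eI eq_sym.
  rewrite nb andbF orbF.
  have [e|->] := bad_third bC ea ec bC'; last by rewrite eqxx.
  by rewrite e eqxx in ab.
case: (eqVneq (emb B b) (first_vtx C)) => [eb|nb] /=; last by rewrite andbF.
have [e|->] := bad_third bC eb ec aC; last by rewrite eqxx.
by rewrite e eqxx in ab.
Qed.

Definition twist f C := [exists a, exists b,
  [&& f a == Some b, emb B a \in vtxs C & walk_val a C (+) walk_val b (walk_ext f C)]].

Definition walk_theta f C x (w : bool) :=
  if bad C && (x \in vtxs C) then w (+) twist f C else w.

(** The bit does not depend on the point: by [walk_val_closing] on [C] and on its image, the values
    of two points differ before [f] exactly when they differ after it. *)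
Lemma twistE f C a b : partial_automorphism f -> bad C ->
  f a = Some b -> emb B a \in vtxs C ->
  twist f C = walk_val a C (+) walk_val b (walk_ext f C).
Proof.
move=> fP bC fab aC; apply/existsP/idP; last first.
  by exists a; apply/existsP; exists b; rewrite fab eqxx aC.
move=> [a' /existsP[b' /and3P[/eqP fab' aC']]].
have [e|ne] := eqVneq a a'; first by move: fab'; rewrite -e fab => -[<-].
have ne' : b != b'.
  apply: contraNneq ne => e; apply/eqP; apply: (pauto_pinj fP) fab _.
  by rewrite fab' e.
have e1 := walk_val_closing ne bC aC aC'.
have := @walk_val_closing (walk_ext f C) b b' ne'.
rewrite bad_ext // -(ext_emb B fP fab) -(ext_emb B fP fab') !mem_vtxs_ext //.
rewrite closing_ext // -e1 => /(_ bC aC aC').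
by do 4 case: walk_val.
Qed.

Lemma twist_none f C : (forall a b, f a = Some b -> emb B a \notin vtxs C) ->
  twist f C = false.
Proof.
move=> fN; apply/existsP=> -[a /existsP[b /and3P[/eqP /fN/negbTE->]]] //.
Qed.

Lemma twist_comp f g h C : coherent_triple f g h -> bad C ->
  twist h C = twist f C (+) twist g (walk_ext f C).
Proof.
move=> ct bC; have [fP gP hP _ emid _] := ct.
have bC' : bad (walk_ext f C) by rewrite bad_ext.
case: (pickP [pred a | isSome (f a) && (emb B a \in vtxs C)]) => [a /=|fN].
  case fab: (f a) => [b|] //= aC; have [c gbc hac] := ct_some1 ct fab.
  rewrite (twistE hP bC hac aC) (twistE fP bC fab aC) (twistE gP bC' gbc).
    by rewrite (walk_ext_comp ct) /= addbA addbK.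
  by rewrite -(ext_emb B fP fab) mem_vtxs_ext.
have fN' a b : f a = Some b -> emb B a \notin vtxs C.
  by move=> e; have := fN a; rewrite /= e /= => ->.
rewrite !twist_none // => a b.
- move=> gab; have := in_pdom gab; rewrite -emid => /prangeP[c fca].
  by rewrite -(ext_emb B fP fca) mem_vtxs_ext //; apply: fN' fca.
- by move=> hab; have [c fac _] := ct_some ct hab; apply: fN' fac.
Qed.

(* The valuations of a bad walk change exactly once around a lift of
   the walk, at its closing edge. *)
Lemma walk_cover : exists (B' : system A delta) (pr : B' -> B),
  no_short_walk u B' n.+1 /\
  forall p q : B', 0 < lab p q -> lab p q = lab (pr p) (pr q).
Proof.
have RS C x y w w' : walk_rel C x y w w' = walk_rel C y x w' w.
  rewrite /walk_rel closing_sym addbC.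
  by case: (x \in vtxs C) (y \in vtxs C) => [] [].
have RE C a b : a != b ->
    walk_rel C (emb B a) (emb B b) (walk_val a C) (walk_val b C).
  by move=> ab; apply/implyP=> /and3P[bC aC bC']; rewrite walk_val_closing.
have thI f C x : partial_automorphism f -> injective (walk_theta f C x).
  by move=> fP w w'; rewrite /walk_theta; case: ifP => // _ /addIb.
have thR f C x y w w' : partial_automorphism f ->
    walk_rel (walk_ext f C) (ext f x) (ext f y)
      (walk_theta f C x w) (walk_theta f C y w') = walk_rel C x y w w'.
  move=> fP; rewrite /walk_rel bad_ext // !mem_vtxs_ext // closing_ext //.
  rewrite /walk_theta; case: (bad C) => //=.
  case: (x \in vtxs C) => //=; case: (y \in vtxs C) => //=.
  by rewrite addbACA addbb addbF.
have thE f C a b : partial_automorphism f -> f a = Some b ->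
    walk_theta f C (emb B a) (walk_val a C) = walk_val b (walk_ext f C).
  move=> fP fab; rewrite /walk_theta; case: ifP => [/andP[bC aC]|].
    by rewrite (twistE fP bC fab aC) addbA addbb.
  rewrite /walk_val bad_ext // -(ext_emb B fP fab) first_vtx_ext.
  rewrite (inj_eq (ext_inj fP)); case: (bad C) => //=.
  by case: eqP => [->|//]; rewrite first_in.
have thC f g h C x w : coherent_triple f g h ->
    walk_theta h C x w =
    walk_theta g (walk_ext f C) (ext f x) (walk_theta f C x w).
  move=> ct; have [fP _ _ _ _ _] := ct.
  rewrite /walk_theta bad_ext // mem_vtxs_ext //; case: ifP => // /andP[bC _].
  by rewrite (twist_comp ct bC) addbA.
have [B' [pr [val labP]]] :=
  valuation_coverP RS RE walk_ext_inj walk_ext_comp thI thR thE thC.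
exists B', pr; split=> [p s sP lp sn|p q /labP[]//].
pose dpr (q : (B' * bool)%type) : D := (pr q.1, q.2).
have adjP q r : adj q r -> adj (dpr q) (dpr r) /\ wt u (dpr q) (dpr r) = wt u q r.
  by rewrite /adj /wt /= => l0; have [<-] := labP _ _ l0.
have projP q t : path (@adj _ _ B') q t ->
    path (@adj _ _ B) (dpr q) (map dpr t) /\
    weight u (dpr q) (map dpr t) = weight u q t.
  elim: t q => //= r t IH q /andP[/adjP[qr ->] /IH[tP ->]].
  by rewrite qr tP.
have [sP' ws] := projP _ _ sP.
have lp' : last (dpr p) (map dpr s) = flip (dpr p) by rewrite last_map lp.
rewrite leqNgt; apply/negP=> wu.
(* A shorter walk would project to one that [shortB] excludes. *)
have {}sn : size s = n.+1.
  apply/eqP; rewrite eqn_leq sn ltnNge; apply/negP=> sn'.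
  by have := shortB sP' lp'; rewrite size_map ws => /(_ sn'); rewrite leqNgt wu.
case/lastP: s => [//|s0 q] in sP lp sn sP' ws lp' wu *.
move: lp; rewrite last_rcons => eq; rewrite {q}eq in sP sn sP' ws {lp'} wu.
have em : map dpr (rcons s0 (flip p)) = rcons (map dpr s0) (flip (dpr p)).
  by rewrite map_rcons.
have s0n : size (map dpr s0) == n by move: sn; rewrite size_rcons size_map => -[->].
pose C : T := (dpr p, Tuple s0n).
have bC : bad C by rewrite /bad /bad_walk /= -em sP' ws.
have memC (r : (B' * bool)%type) : r \in p :: s0 -> pr r.1 \in vtxs C.
  by move=> rs; exact: (map_f fst (map_f dpr rs)).
have firstN s1 q s2 : s0 = s1 ++ q :: s2 -> pr q.1 != first_vtx C.
  move=> e; apply: (@bad_walk_neq_first _ _ u B delta_lt n (dpr p) (dpr q)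
    (map dpr s1) (map dpr s2) shortB);
    by rewrite -map_cons -map_cat -e // (eqP s0n).
have lastN s1 q s2 : s0 = s1 ++ q :: s2 -> 0 < size s2 -> pr q.1 != last_vtx C.
  move=> e s2n; rewrite /last_vtx /= e map_cat last_cat /=.
  apply: (@bad_walk_neq_last _ _ u B delta_lt n (dpr p) (dpr q)
    (map dpr s1) (map dpr s2) shortB);
    by rewrite ?size_map // -map_cons -map_cat -e // (eqP s0n).
(* No step before the last projects to the closing edge, so the bit stays constant up to the last
   intermediate vertex. *)
have valC s1 s2 : s0 = s1 ++ s2 -> val (last p s1).1 C = val p.1 C.
  elim/last_ind: s1 s2 => [//|s1 q IH] s2; rewrite cat_rcons last_rcons => e.
  rewrite -(IH _ e).
  have lq : adj (last p s1) q.
    by move: sP; rewrite e rcons_cat rcons_cons cat_path /= => /and3P[].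
  have [_ /(_ C)] := labP _ _ lq; rewrite /walk_rel bC !memC; first last.
  - by rewrite e -cat_cons mem_cat mem_last.
  - by rewrite e inE mem_cat inE eqxx !orbT.
  rewrite /closing (negbTE (firstN _ _ _ e)) andbF orbF /=.
  suff -> : (pr (last p s1).1 == first_vtx C) && (pr q.1 == last_vtx C) = false.
    by case: (val _ _) (val _ _) => [] [].
  apply/negP=> /andP[/eqP xf /eqP yl].
  (* A first step leads to an intermediate vertex which, as [n > 1], is not the last one. A later
     step starts at an intermediate vertex, which does not lie over the first. *)
  case/lastP: s1 => [|s1 r] in {IH lq} e xf *.
    have s20 : 0 < size s2.
      by move: (eqP s0n); rewrite size_map e /=; lia.
    by have := lastN _ _ _ e s20; rewrite yl eqxx.
  by move: e; rewrite cat_rcons => /firstN; rewrite last_rcons in xf; rewrite xf eqxx.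
(* The final step requires a change of the bit, but [flip p] has the same underlying vertex as [p],
   hence the same bit as [last p s0]. *)
have lp2 : adj (last p s0) (flip p) by move: sP; rewrite rcons_path => /andP[].
have [_ /(_ C)] := labP _ _ lp2.
rewrite [(flip p).1]/= (valC s0 [::]) ?cats0 // /walk_rel bC addbb !memC ?mem_head ?mem_last //=.
by rewrite /closing /last_vtx /= last_map !eqxx orbT.
Qed.

End WalkCover.

(** * Completion *)

Section Completion.

Variables (A : finMetricSpace) (delta u : nat) (B : system A delta).
Hypothesis delta_gt2 : 2 < delta.
Hypothesis delta_lt : delta < u.
Hypothesis shortB : no_short_walk u B u.

Local Notation D := (B * bool)%type.
Implicit Types (P Q Z : D) (s : seq D) (x y z : B).

Lemma closed_walk P s :
  path (@adj _ _ B) P s -> last P s = flip P -> u <= weight u P s.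
Proof.
move=> sP lP; have [/(shortB sP lP)//|us] := leqP (size s) u.
exact: leq_trans (ltnW us) (size_le_weight delta_lt sP).
Qed.

Definition reach w P Q := [exists n : 'I_u, exists s : n.-tuple D,
  [&& path (@adj _ _ B) P s, last P s == Q & weight u P s == w]].

(** Path distance truncated at [u], the value that [find] returns on failure. Fewer than [u] steps
    suffice in [reach], because a walk has at most as many steps as its weight. *)
Definition ddist P Q := find (fun w => reach w P Q) (iota 0 u).

Lemma ddist_le_u P Q : ddist P Q <= u.
Proof. by rewrite -[X in _ <= X](size_iota 0) find_size. Qed.

Lemma ddist_le P s : path (@adj _ _ B) P s -> ddist P (last P s) <= weight u P s.
Proof.
move=> sP; have [uw|wu] := leqP u (weight u P s).
  exact: leq_trans (ddist_le_u _ _) uw.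
rewrite leqNgt; apply/negP=> lt.
have := before_find 0 lt; rewrite nth_iota // add0n.
suff -> : reach (weight u P s) P (last P s) by [].
have su : size s < u by apply: leq_ltn_trans (size_le_weight delta_lt sP) wu.
apply/existsP; exists (Ordinal su); apply/existsP; exists (in_tuple s).
by rewrite /= sP !eqxx.
Qed.

Lemma ddist_walk P Q : ddist P Q < u -> exists s,
  [/\ path (@adj _ _ B) P s, last P s = Q & weight u P s = ddist P Q].
Proof.
move=> du; have: has (fun w => reach w P Q) (iota 0 u) by rewrite has_find size_iota.
move/(nth_find 0); rewrite nth_iota // add0n => /existsP[n /existsP[s]].
by move=> /and3P[sP /eqP lP /eqP ws]; exists s.
Qed.

Lemma ddist_triangle P Q Z : ddist P Z <= ddist P Q + ddist Q Z.
Proof.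
have lePZ := ddist_le_u P Z.
have [?|/ddist_walk[s [sP lP ws]]] := leqP u (ddist P Q); first lia.
have [?|/ddist_walk[t [tP lQ wt]]] := leqP u (ddist Q Z); first lia.
rewrite -ws -wt -lQ -lP -last_cat -weight_cat; apply: ddist_le.
by rewrite cat_path sP lP.
Qed.

Lemma rev_walk P s : path (@adj _ _ B) P s -> exists t,
  [/\ path (@adj _ _ B) (last P s) t, last (last P s) t = P &
    weight u (last P s) t = weight u P s].
Proof.
elim: s P => [|Q s IH] P /=; first by exists [::].
move=> /andP[PQ /IH[t [tP lt wt]]]; exists (rcons t P).
rewrite rcons_path last_rcons weight_rcons tP lt wt wt_sym addnC /adj lab_sym.
by [].
Qed.

Lemma ddist_sym P Q : ddist P Q = ddist Q P.
Proof.
wlog suff le : P Q / ddist P Q <= ddist Q P.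
  by apply/eqP; rewrite eqn_leq !le.
have [?|/ddist_walk[s [sP lP <-]]] := leqP u (ddist Q P).
  by apply: leq_trans (ddist_le_u P Q) _.
have [t [tP lt <-]] := rev_walk sP; rewrite lP in tP lt *.
by rewrite -{1}lt; apply: ddist_le.
Qed.

Lemma ddist_map (phi : D -> D) P Q :
  (forall P Q, adj (phi P) (phi Q) = adj P Q) ->
  (forall P Q, wt u (phi P) (phi Q) = wt u P Q) ->
  ddist (phi P) (phi Q) <= ddist P Q.
Proof.
move=> phiA phiW.
have [?|/ddist_walk[s [sP <- <-]]] := leqP u (ddist P Q).
  by apply: leq_trans (ddist_le_u _ _) _.
have -> : weight u P s = weight u (phi P) (map phi s).
  by elim: s P {sP} => //= R s IH P; rewrite IH phiW.
rewrite -last_map; apply: ddist_le; rewrite path_map.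
by rewrite (eq_path (e' := @adj _ _ B)).
Qed.

Lemma ddist_flip P Q : ddist (flip P) (flip Q) = ddist P Q.
Proof.
apply/eqP; rewrite eqn_leq -{3}[P]flipK -{3}[Q]flipK.
by rewrite !ddist_map // => *; rewrite wt_flip2.
Qed.

Lemma ddist_edge P Q : adj P Q -> ddist P Q <= wt u P Q.
Proof.
by move=> PQ; have := @ddist_le P [:: Q]; rewrite /= PQ addn0; apply.
Qed.

Lemma ddist_closed P : u <= ddist P (flip P).
Proof.
rewrite leqNgt; apply/negP=> lt; have [s [sP lP ws]] := ddist_walk lt.
by have := closed_walk sP lP; rewrite ws leqNgt lt.
Qed.

Lemma weight_odd P s : path (@adj _ _ B) P s ->
  odd (weight u P s) =
  par P.1 (+) par (last P s).1 (+) ((P.2 (+) (last P s).2) && odd u).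
Proof.
elim: s P => [|Q s IH] P /=; first by rewrite !addbb.
move=> /andP[PQ /IH e]; rewrite oddD {}e.
have -> : odd (wt u P Q) = par P.1 (+) par Q.1 (+) ((P.2 (+) Q.2) && odd u).
  have := PQ; rewrite /adj /wt -(lab_par PQ); have := lab_le P.1 Q.1.
  case: ifP => [|_]; first by lia.
  case: P.2 Q.2 => [] [] //= lD _; rewrite ?addbF //.
    by rewrite oddB 1?addbC //; lia.
  by rewrite oddB 1?addbC //; lia.
by do 3 case: (par _); case: P.2 Q.2 (last Q s).2 (odd u) => [] [] [] [].
Qed.

Lemma ddist_odd P Q : ddist P Q < u ->
  odd (ddist P Q) = par P.1 (+) par Q.1 (+) ((P.2 (+) Q.2) && odd u).
Proof. by move=> /ddist_walk[s [sP <- <-]]; apply: weight_odd. Qed.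

Lemma ddist_gt0 P Q : P != Q -> 0 < ddist P Q.
Proof.
rewrite lt0n; apply: contraNneq => d0.
have [|s [sP ls ws]] := @ddist_walk P Q; first by rewrite d0; lia.
have := size_le_weight delta_lt sP; rewrite ws d0 leqn0 size_eq0 => /eqP s0.
by rewrite -ls s0.
Qed.

(** Some step changes the sign and weighs at least [u - delta]; each other step weighs at least
    1. *)
Lemma weight_flip P s : path (@adj _ _ B) P s -> P.2 != (last P s).2 ->
  u - delta + (size s).-1 <= weight u P s.
Proof.
elim: s P => [|Q s IH] P /=; first by rewrite eqxx.
move=> /andP[PQ sP]; case: (eqVneq P.2 Q.2) => [-> /(IH _ sP)|ne _].
  have := wt_gt0 delta_lt PQ; case: s {IH sP} => /=; lia.
have sw : size s <= weight u Q s := size_le_weight delta_lt sP.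
have := lab_le P.1 Q.1; move: PQ.
by rewrite /adj /wt (negbTE ne); case: ifP; lia.
Qed.

(** * The clamped distance and its bounds *)

Definition upper x y := ddist (x, true) (y, true).
Definition lower x y := u - ddist (x, true) (y, false).
Definition magic (b : bool) :=
  if odd delta./2 == b then delta./2 else (delta./2).+1.

Definition completion x y :=
  if x == y then 0
  else maxn (lower x y) (minn (upper x y) (magic (par x (+) par y))).

Lemma magicP b : odd (magic b) = b /\ delta./2 <= magic b <= (delta./2).+1.
Proof. by rewrite /magic; case: eqP => [<-|]; case: b; lia. Qed.

Lemma upper_sym x y : upper x y = upper y x.
Proof. exact: ddist_sym. Qed.

Lemma lower_sym x y : lower x y = lower y x.
Proof.
rewrite /lower ddist_sym; have := ddist_flip (y, false) (x, true).
by rewrite /flip /= => ->.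
Qed.

Lemma lower_le_upper x y : lower x y <= upper x y.
Proof.
rewrite lower_sym /lower /upper.
have := ddist_closed (x, true); have := ddist_triangle (x, true) (y, true) (x, false).
by rewrite /flip /=; lia.
Qed.

Lemma upper_triangle x y z : upper x z <= upper x y + upper y z.
Proof. exact: ddist_triangle. Qed.

Lemma lower_triangle x y z : lower y z <= upper x y + lower x z.
Proof.
have := ddist_triangle (x, true) (y, true) (z, false).
by rewrite /lower /upper; lia.
Qed.

(** This is the triangle inequality of path distances through the negative copy of [y], with each
    distance between opposite signs rewritten as [u] minus a lower bound. *)
Lemma upper_perimeter x y z :
  upper x z + lower x y + lower y z <= u.*2.
Proof.
have := ddist_triangle (x, true) (y, false) (z, true).
have := ddist_flip (y, true) (z, false); rewrite /flip /= => ->.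
have := ddist_le_u (x, true) (y, false); have := ddist_le_u (y, true) (z, false).
have := ddist_le_u (x, true) (z, true).
by rewrite /lower /upper; lia.
Qed.

Lemma lower_le x y : x != y -> lower x y <= delta.
Proof.
move=> xy; rewrite /lower.
have [|/ddist_walk[s [sP ls <-]]] := leqP u (ddist (x, true) (y, false)); first lia.
by have := weight_flip sP; rewrite ls => /(_ isT); lia.
Qed.

Lemma completion_facts x y : x != y ->
  [/\ lower x y <= completion x y <= upper x y, 0 < completion x y <= delta,
      odd (completion x y) = par x (+) par y,
      completion x y = upper x y \/ magic (par x (+) par y) <= completion x y &
      completion x y = lower x y \/ completion x y <= magic (par x (+) par y)].
Proof.
move=> xy; rewrite /completion (negbTE xy).
have [om mm] := magicP (par x (+) par y).
have lu := lower_le_upper x y; have ld := lower_le xy.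
have u0 : 0 < upper x y by apply: ddist_gt0; apply: contraNneq xy => -[->].
split; try lia.
(* The truncated values, 0 for [lower] and [u] for [upper], carry no parity. Clamping selects
   [lower] only from [magic] upwards and [upper] only up to [magic], and [magic] lies strictly
   between 0 and [u]. *)
have oL : 0 < lower x y -> odd (lower x y) = par x (+) par y.
  move=> l0; rewrite /lower oddB ?ddist_le_u //.
  by rewrite ddist_odd /= ?addbA; [case: (odd u) (par x) (par y) => [] [] []|move: l0; rewrite /lower; lia].
have oU : upper x y < u -> odd (upper x y) = par x (+) par y.
  by move=> uu; rewrite /upper ddist_odd // !addbF.
set L := lower x y in lu ld oL *; set U := upper x y in lu u0 oU *.
set m := magic _ in om mm *.
have [->|[[-> Lm]|[-> Um]]] : maxn L (minn U m) = m \/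
    (maxn L (minn U m) = L /\ m <= L) \/ (maxn L (minn U m) = U /\ U <= m) by lia.
- by [].
- by apply: oL; lia.
- by apply: oU; lia.
Qed.

Lemma completion_sym x y : completion x y = completion y x.
Proof.
by rewrite /completion eq_sym lower_sym upper_sym addbC.
Qed.

(** If both sides on the right equal their upper bounds, or one does and the left side equals its
    lower bound, path distances give the inequality. In the other cases it follows from parity and
    from [magic] being within 1 of [delta./2]. *)
Lemma completion_triangle_distinct x y z : x != y -> y != z -> x != z ->
  completion x z <= completion x y + completion y z.
Proof.
move=> xy yz xz.
have [lu1 d1 o1 U1 L1] := completion_facts xy.
have [lu2 d2 o2 U2 L2] := completion_facts yz.
have [lu3 d3 o3 U3 L3] := completion_facts xz.
have [m1 n1] := magicP (par x (+) par y).
have [m2 n2] := magicP (par y (+) par z).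
have [m3 n3] := magicP (par x (+) par z).
have t1 := upper_triangle x y z.
have t2 := lower_triangle y x z; rewrite [upper y x]upper_sym in t2.
have t3 := lower_triangle y z x.
rewrite [lower y x]lower_sym [lower z x]lower_sym in t3.
case: U1 U2 => [U1|U1] [U2|U2].
- by clear -U1 U2 t1 lu3; lia.
- case: L3 => L3; first by clear -L3 t2 U1 lu2; lia.
  clear -d1 o1 U2 L3 m2 m3 n2 n3.
  by case: (par x) (par y) (par z) o1 U2 L3 m2 m3 n2 n3 => [] [] [] /=; lia.
- case: L3 => L3; first by clear -L3 t3 U2 lu1; lia.
  clear -d2 o2 U1 L3 m1 m3 n1 n3.
  by case: (par x) (par y) (par z) o2 U1 L3 m1 m3 n1 n3 => [] [] [] /=; lia.
- clear -U1 U2 d3 o3 m1 m2 n1 n2.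
  by case: (par x) (par y) (par z) o3 U1 U2 m1 m2 n1 n2 => [] [] [] /=; lia.
Qed.

(** Two sides at their lower bounds reduce the claim to [upper_perimeter]. Otherwise two sides are
    at most [magic] and the third at most [delta], giving at most [2 * delta + 2], hence at most
    [u.*2]. *)
Lemma completion_perimeter x y z : x != y -> y != z -> x != z ->
  completion x y + completion y z + completion x z <= u.*2.
Proof.
move=> xy yz xz.
have [lu1 d1 o1 U1 L1] := completion_facts xy.
have [lu2 d2 o2 U2 L2] := completion_facts yz.
have [lu3 d3 o3 U3 L3] := completion_facts xz.
have [m1 n1] := magicP (par x (+) par y).
have [m2 n2] := magicP (par y (+) par z).
have [m3 n3] := magicP (par x (+) par z).
have t1 := upper_perimeter x y z.
have t2 := upper_perimeter y x z; rewrite [lower y x]lower_sym in t2.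
have t3 := upper_perimeter x z y; rewrite [lower z y]lower_sym in t3.
case: L1 L2 L3 => [L1|L1] [L2|L2] [L3|L3].
- by clear -L1 L2 lu3 t1; lia.
- by clear -L1 L2 lu3 t1; lia.
- by clear -L1 L3 lu2 t2; lia.
- clear -delta_lt L2 L3 d1 o1 m2 m3 n2 n3.
  by case: (par x) (par y) (par z) o1 L2 L3 m2 m3 n2 n3 => [] [] [] /=; lia.
- by clear -L2 L3 lu1 t3; lia.
- clear -delta_lt L1 L3 d2 o2 m1 m3 n1 n3.
  by case: (par x) (par y) (par z) o2 L1 L3 m1 m3 n1 n3 => [] [] [] /=; lia.
- clear -delta_lt L1 L2 d3 o3 m1 m2 n1 n2.
  by case: (par x) (par y) (par z) o3 L1 L2 m1 m2 n1 n2 => [] [] [] /=; lia.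
- clear -delta_lt L1 L2 d3 o3 m1 m2 n1 n2.
  by case: (par x) (par y) (par z) o3 L1 L2 m1 m2 n1 n2 => [] [] [] /=; lia.
Qed.

Lemma completion_odd x y : odd (completion x y) = par x (+) par y.
Proof.
have [->|/completion_facts[]//] := eqVneq x y.
by rewrite /completion eqxx addbb.
Qed.

Lemma completion_is_metric : is_metric completion.
Proof.
have d0 x : completion x x = 0 by rewrite /completion eqxx.
split=> [x y|x y|x y z]; last 1 first.
- have [->|xz] := eqVneq x z; first by rewrite d0.
  have [->|xy] := eqVneq x y; first by rewrite d0.
  have [->|yz] := eqVneq y z; first by rewrite d0 addn0.
  exact: completion_triangle_distinct.
- split=> [|->]; last by rewrite d0.
  by move=> e; apply/eqP; apply: contraTT isT => /completion_facts[_ + _ _ _]; rewrite e.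
- exact: completion_sym.
Qed.

(** The edge squeezes the value: between equal signs it bounds [upper] above by the label, between
    opposite signs it bounds [lower] below by it. *)
Lemma completion_lab x y : 0 < lab x y -> completion x y = lab x y.
Proof.
move=> l0; have xy : x != y by apply: contraTneq l0 => ->; rewrite lab_irr.
have [lu _ _ _ _] := completion_facts xy.
have := @ddist_edge (x, true) (y, true) l0.
have := @ddist_edge (x, true) (y, false) l0.
rewrite /wt /= -/(upper x y); move: lu; rewrite /lower.
by have := lab_le x y; case: ifP; lia.
Qed.

Lemma completion_emb (a b : A) : completion (emb B a) (emb B b) = fdist a b.
Proof.
have [->|ab] := eqVneq a b.
  by rewrite /completion eqxx; apply/esym/(metric_eq0 (@fdist_metric A)).
rewrite -(lab_emb B) completion_lab // lab_emb lt0n; apply: contraNneq ab.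
by move/(metric_eq0 (@fdist_metric A)) ->.
Qed.

Lemma completion_ext (f : pfun A) x y : partial_automorphism f ->
  completion (ext f x) (ext f y) = completion x y.
Proof.
move=> fP; have fI := ext_inj (s := B) fP.
have dE P Q : ddist (dext f P) (dext f Q) = ddist P Q.
  (* Transporting walks gives one inequality; the inverse, which exists by finiteness, gives the
     other. *)
  have [g fK gK] := injF_bij fI.
  pose dg (R : D) : D := (g R.1, R.2).
  have dgK R : dg (dext f R) = R by case: R => ? ?; rewrite /dg /= fK.
  have gl x' y' : lab (g x') (g y') = lab x' y' by rewrite -(ext_lab fP) !gK.
  apply/eqP; rewrite eqn_leq; apply/andP; split.
    by apply: ddist_map => R S; rewrite /adj /wt /= ext_lab.
  rewrite -{1}[P]dgK -{1}[Q]dgK.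
  by apply: ddist_map => R S; rewrite /adj /wt /= gl.
rewrite /completion (inj_eq fI) ext_par //.
by rewrite /lower /upper -!(dE (x, true)).
Qed.

(** Here [magic] is below [delta], so the value comes from [lower], through a walk of weight
    [u - delta] between opposite signs. By [weight_flip] this walk is a single edge. *)
Lemma completion_delta x y : 3 < delta -> x != y ->
  completion x y = delta -> lab x y = delta.
Proof.
move=> d3 xy e; have [_ _ _ _ []] := completion_facts xy; rewrite e; last first.
  by have [_] := magicP (par x (+) par y); lia.
move=> eL; have du : ddist (x, true) (y, false) = u - delta.
  by have := ddist_le_u (x, true) (y, false); move: eL; rewrite /lower; lia.
have [|s [sP ls ws]] := @ddist_walk (x, true) (y, false); first by rewrite du; lia.
have := weight_flip sP; rewrite ls ws du => /(_ isT) sz.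
case: s => [|Q [|Z s]] in sP ls ws sz *; [by []| |by move: sz => /=; lia].
move: ws; rewrite /= in ls; rewrite du ls /= addn0 /wt /=.
by have := lab_le x y; case: ifP; lia.
Qed.

End Completion.

(** * Henson constraints and the theorem *)

(** The sides are the parities of the distance to a fixed point. *)
Lemma side_exists (A : finMetricSpace) :
  (forall a b c : A, a != b -> b != c -> a != c ->
     ~~ odd (fdist a b + fdist b c + fdist a c)) ->
  exists side : A -> bool, forall a b, odd (fdist a b) = side a (+) side b.
Proof.
move=> evenA; case: (pickP (@predT A)) => [o _|A0]; last first.
  by exists xpredT => a; have := A0 a.
have d0 (a : A) : fdist a a = 0 by apply/(metric_eq0 (@fdist_metric A)).
have sym := metric_sym (@fdist_metric A).
exists (fun a => odd (fdist o a)) => a b.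
have [->|ab] := eqVneq a b; first by rewrite d0 addbb.
have [->|oa] := eqVneq o a; first by rewrite d0.
have [->|ob] := eqVneq o b; first by rewrite d0 addbF sym.
have := evenA _ _ _ oa ab ob; rewrite !oddD.
by do 3 case: odd.
Qed.

Section UnwoundSystem.

Variables (A : finMetricSpace) (delta u K : nat).
Hypothesis delta_gt0 : 0 < delta.
Hypothesis delta_lt : delta < u.
Hypothesis dist_le : forall a b : A, fdist a b <= delta.
Hypothesis evenA : forall a b c : A, a != b -> b != c -> a != c ->
  ~~ odd (fdist a b + fdist b c + fdist a c).
Hypothesis triangleA : forall a b c : A, a != b -> b != c -> a != c ->
  fdist a b + fdist b c + fdist a c <= u.*2.
Hypothesis cliqueA : forall X : {set A}, clique (@fdist A) delta X -> #|X| <= K.+1.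

(** Cliques are bounded once, at the start. Each walk cover then gains one step, and its projection
    is injective on [delta]-cliques, so the clique bound survives. *)
Lemma unwound_system n : exists B : system A delta,
  no_short_walk u B n.+2 /\
  forall X : {set B}, clique (@lab _ _ B) delta X -> #|X| <= K.+1.
Proof.
elim: n => [|n [B [shortB cliqueB]]].
  have [side sideP] := side_exists evenA.
  have [B cliqueB] := clique_cover (base sideP dist_le) delta_gt0 cliqueA.
  by exists B; split; first exact: no_short_walk2.
have [B' [pr [shortB' prP]]] := walk_cover delta_lt (n := n.+2) isT triangleA shortB.
exists B'; split=> // X /cliqueP cX.
have labX p q : p \in X -> q \in X -> p != q -> lab (pr p) (pr q) = delta.
  by move=> pX qX pq; rewrite -prP cX.
have prI : {in X &, injective pr}.
  move=> p q pX qX e; apply: contraTeq delta_gt0 => /(labX _ _ pX qX).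
  by rewrite e lab_irr => <-.
rewrite -(card_in_imset prI); apply/cliqueB/cliqueP.
move=> _ _ /imsetP[p pX ->] /imsetP[q qX ->] pq.
by apply: labX => //; apply: contraNneq pq => ->.
Qed.

End UnwoundSystem.

Lemma dist_eq0 (X : metricSpace) (x y : X) : dist x y == 0 -> x = y.
Proof. by move/eqP/(metric_eq0 (@dist_metric X)). Qed.

Lemma exists_third_point (H : metricSpace) (p : 'I_4 -> H) (x y : H) :
  injective p -> exists z, x <> z /\ y <> z.
Proof.
move=> pI; case: (pselect (exists z, x <> z /\ y <> z)) => // no.
have col i : x = p i \/ y = p i.
  by case: (pselect (x = p i)) (pselect (y = p i)) => [?|?] [?|?]; [left|left|right|case: no; exists (p i)].
have e (i j k : 'I_4) : i != j -> j != k -> i != k -> False.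
  move=> /eqP ij /eqP jk /eqP ik.
  by case: (col i) (col j) (col k) => [ei|ei] [ej|ej] [ek|ek];
    first [case: ij; apply: pI; congruence | case: jk; apply: pI; congruence
          | case: ik; apply: pI; congruence].
by case: (e (@Ordinal 4 0 isT) (@Ordinal 4 1 isT) (@Ordinal 4 2 isT)).
Qed.

(* Parity and the triangle inequality exclude distance 1, so the constraints
   are equilateral, and a triangle of side [delta] has to have even perimeter. *)
Lemma henson_equilateral (delta C0 : nat) (S : metricSpace -> Prop) H :
  3 <= delta -> admissible delta C0 S -> S H ->
  ~~ odd delta /\ forall x y : H, x <> y -> dist x y = delta.
Proof.
move=> d3 aS SH; have [hens [p pI] noT] := aS _ SH.
have tri := metric_triangle (@dist_metric H).
have sym := metric_sym (@dist_metric H).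
have even (x y z : H) : x <> y -> y <> z -> x <> z -> ~~ odd (perimeter x y z).
  move=> xy yz xz; apply/negP=> o; apply: (noT x y z) => //; left; exact: o.
have main (x y : H) : x <> y -> ~~ odd delta /\ dist x y = delta.
  move=> xy; have [z [xz yz]] := exists_third_point x y pI.
  have := even _ _ _ xy yz xz; rewrite /perimeter.
  have := tri x y z; have := tri x z y; have := tri y x z.
  rewrite (sym z y) (sym y x).
  by case: (hens _ _ xy) (hens _ _ yz) (hens _ _ xz) => [->|->] [->|->] [->|->]; lia.
split=> [|x y /main[]//].
have: p ord0 <> p ord_max by move=> /pI /(congr1 val).
by move/main => -[].
Qed.

Lemma injective_isometry_automorphism (B : finMetricSpace) (s : B -> B) :
  injective s -> (forall x y, fdist (s x) (s y) = fdist x y) -> automorphism s.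
Proof. by move=> sI sd; split=> //; apply: injF_bij. Qed.

Theorem theorem6p16 (delta C0 : nat) (S : metricSpace -> Prop)
    (hdelta : 3 <= delta)
    (hC0 : 2 * delta + 3 < C0) (hC0_even : ~~ odd C0)
    (hC0_le : C0 <= 3 * delta + 2)
    (hS : admissible delta C0 S) :
  coherent_EPPA (fun X => bipartite_class delta C0 X /\ omitting_class S X).
Proof.
move=> A [[rangeA noTA] omA].
(* An even perimeter is below [C0] exactly when it is at most [u.*2]. *)
pose u := (C0./2).-1; have C0E : C0 = u.*2.+2 by rewrite /u; lia.
have delta_lt : delta < u by lia.
have dist_le (a b : A) : fdist a b <= delta.
  have [->|/eqP /rangeA/andP[]//] := eqVneq a b.
  by rewrite ((metric_eq0 (@fdist_metric A) b b).2 erefl).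
have noTA' (a b c : A) : a != b -> b != c -> a != c ->
    ~~ odd (fdist a b + fdist b c + fdist a c) /\
    fdist a b + fdist b c + fdist a c <= u.*2.
  move=> /eqP ab /eqP bc /eqP ac; have noT := noTA a b c (And3 ab bc ac).
  have even : ~~ odd (fdist a b + fdist b c + fdist a c).
    by apply/negP=> o; apply: noT; left.
  split=> //; rewrite leqNgt; apply/negP=> lt; apply: noT; right; split=> //.
  by rewrite /perimeter /=; lia.
(* The size of a largest [delta]-clique of [A] serves as the bound on cliques of [B]. The form
   [#|Y|.-1.+1] also covers an empty [A]. *)
pose Y := [arg max_(X > set0 | clique (@fdist A) delta X) #|X|]%N.
have [cY maxY] : clique (@fdist A) delta Y /\
    forall X, clique (@fdist A) delta X -> #|X| <= #|Y|.
  rewrite /Y; case: arg_maxnP => [|Z cZ maxZ]; last by split.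
  by apply/cliqueP=> x y; rewrite inE.
have cliqueA X : clique (@fdist A) delta X -> #|X| <= #|Y|.-1.+1.
  by move/maxY; lia.
have [B [shortB' cliqueB]] := @unwound_system A delta u #|Y|.-1
  (ltnW (ltnW hdelta)) delta_lt dist_le
  (fun a b c ab bc ac => (noTA' a b c ab bc ac).1)
  (fun a b c ab bc ac => (noTA' a b c ab bc ac).2) cliqueA u.-2.
have shortB : no_short_walk u B u by move: shortB'; have -> : u.-2.+2 = u by lia.
have facts := completion_facts hdelta delta_lt shortB.
exists (FinMetricSpace (completion_is_metric hdelta delta_lt shortB)), (emb B), (@ext _ _ B).
split.
- split; [split|].
  + by move=> x y /eqP xy; have [_ + _ _ _] := facts _ _ xy.
  + move=> x y z [/eqP xy /eqP yz /eqP xz]; rewrite /perimeter /=.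
    have := completion_perimeter hdelta delta_lt shortB xy yz xz.
    have odd3 : ~~ odd (completion u x y + completion u y z + completion u x z).
      rewrite !oddD !(completion_odd hdelta delta_lt shortB).
      by do 3 case: (par _).
    by move=> le; case=> [|[_]]; [apply/negP|lia].
  + move=> H SH [j jI]; apply: (omA H SH).
    have [even_delta eqH] := henson_equilateral hdelta hS SH.
    have [_ [p pI] _] := hS _ SH.
    have j_inj : injective j.
      move=> x y e; apply: dist_eq0; rewrite -jI e.
      by rewrite ((metric_eq0 (@dist_metric _) _ _).2 erefl).
    (* The image of a constraint in [B] is a [delta]-clique no larger than [Y]. Matching positions
       in the enumerations of [X] and [Y] then embeds the constraint in [A]. *)
    pose X : {set B} := [set b : B | `[< exists x, j x = b >]].
    have inX x : j x \in X by rewrite inE; apply/asboolP; exists x.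
    have cX : clique (@lab _ _ B) delta X.
      apply/cliqueP=> b c; rewrite !inE => /asboolP[x <-] /asboolP[y <-] /eqP xy.
      (* As [delta] is even and at least 3, it exceeds 3. *)
      apply: (@completion_delta _ _ u B hdelta delta_lt shortB); first by lia.
        exact/eqP.
      have := jI x y; rewrite /= => ->; apply: eqH => e; apply: xy.
      by rewrite e.
    have X4 : 4 <= #|X|.
      have <- : #|(fun i => j (p i)) @: 'I_4| = 4.
        by rewrite card_imset ?card_ord // => i k /j_inj/pI.
      by apply/subset_leq_card/subsetP=> _ /imsetP[i _ ->].
    (* The four points of [X] rule out an empty [Y], where the bound [#|Y|.-1.+1] would be larger
       than [#|Y|]. *)
    have XY : #|X| <= #|Y| by have := cliqueB _ cX; lia.
    have rk x : index (j x) (enum X) < size (enum Y).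
      by rewrite -cardE; apply: leq_trans XY; rewrite cardE index_mem mem_enum.
    have [a0 _] : exists a : A, a \in Y.
      by apply/card_gt0P; lia.
    pose k x := nth a0 (enum Y) (index (j x) (enum X)).
    exists k => x y.
    case: (pselect (x = y)) => [->|xy].
      by rewrite !((metric_eq0 (@dist_metric _) _ _).2 erefl).
    rewrite eqH //; apply: (cliqueP _ _ _ cY).
    * by rewrite -mem_enum mem_nth.
    * by rewrite -mem_enum mem_nth.
    rewrite nth_uniq ?enum_uniq //; apply: contra_notN xy => /eqP e.
    apply: j_inj; rewrite -(nth_index (j x) (s := enum X) (x := j x)) ?mem_enum //.
    by rewrite e nth_index ?mem_enum.
- by move=> a b; apply: completion_emb.
- move=> f fP; split; last by move=> a b; apply: ext_emb.
  apply: injective_isometry_automorphism; first exact: ext_inj.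
  by move=> x y; apply: completion_ext.
- by move=> f g h fP gP hP edom emid eran ecomp; apply: ext_comp.
Qed.
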